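(* Let $\mathcal{O}$ be any finite set of function-preserving $\mathrm{GSO}$-definable operations on binary relations. Then there is a function-preserving operation $O$ on binary relations that is term definable in $\mathbb{TRA}$ but not term definable in $\mathbb{BRA}(\mathcal{O})$, even over finite structures in which all relations are partial functions (i.e., no term of $\mathbb{BRA}(\mathcal{O})$ agrees with $O$ on all finite structures in which every relation is a partial function).
   Context: Structures have signatures consisting of binary relation symbols only. An $n$-ary operation on binary relations is an isomorphism-invariant map $O$ sending each structure $A=(\mathrm{dom}(A),R_1^A,\dots,R_n^A)$ to a binary relation $O(A)\subseteq \mathrm{dom}(A)^2$. For a set $\mathcal{O}$ of operations, $\mathbb{BRA}(\mathcal{O})$ has as $n$-ary terms the expressions built from relation symbols $R_1,\dots,R_n$ using operations in $\mathcal{O}$; an operation is term definable in $\mathbb{BRA}(\mathcal{O})$ (over a class of structures) if some term defines the same relation as it on every structure (of the class). $\mathbb{TRA}=\mathbb{BRA}(\mathrm{id},\emptyset,-,\cap,\circ,{}^\smile)$ (identity relation, empty relation, complement, intersection, composition, inverse). An operation $O$ is function preserving if whenever every $R_i^A$ is a partial function on $\mathrm{dom}(A)$, then $O(A)$ is a partial function on $\mathrm{dom}(A)$. Guarded second-order logic $\mathrm{GSO}$ extends first-order logic with quantification over sets of elements and quantification over subsets of the interpretations of relation symbols of the signature. An operation $O$ is $\mathrm{GSO}$-definable if there is a $\mathrm{GSO}$-formula $\phi(x,y)$ with $O(A)=\{(a,b)\mid A\models\phi(a,b)\}$ for all $A$. *)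

(* Defs.v *)
From mathcomp Require Import all_boot.
From mathcomp Require Import boolp classical_sets functions cardinality.

Set Implicit Arguments.
Unset Strict Implicit.
Unset Printing Implicit Defensive.

Local Open Scope classical_set_scope.
Local Open Scope relation_scope.

(* The relation symbols R_1, ..., R_n are indexed from 0 by 'I_n.  Empty
   domains are allowed; they support only the empty binary relation. *)
Record structure (n : nat) := Structure {
  dom : Type;
  rel_of : 'I_n -> set (dom * dom) }.
Arguments rel_of {n} s _.

Definition isomorphism (n : nat) (A B : structure n) (f : dom A -> dom B) :=
  bijective f /\
  forall i x y, rel_of A i (x, y) <-> rel_of B i (f x, f y).

Record operation := Operation {
  arity : nat;
  apply_op : forall A : structure arity, set (dom A * dom A);
  op_invariant : forall (A B : structure arity) (f : dom A -> dom B),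
    isomorphism f ->
    forall x y, @apply_op A (x, y) <-> @apply_op B (f x, f y) }.
Arguments apply_op : clear implicits.

Definition partial_function (D : Type) (R : set (D * D)) :=
  is_fun (fun x y => R (x, y)).

Definition all_partial_functions (n : nat) (A : structure n) :=
  forall i, partial_function (rel_of A i).

Definition finite_structure (n : nat) (A : structure n) :=
  finite_set [set: dom A].

Definition function_preserving (o : operation) :=
  forall A : structure (arity o),
    all_partial_functions A -> partial_function (apply_op o A).

(* Sets of operations and classes of structures are plain predicates: [set] is
   bound to the universe of [predArgType], and instantiating it at these large
   types would prevent types such as 'I_k from being the domain of a
   structure. *)
Definition finite_operations (OO : operation -> Prop) :=
  exists (k : nat) (f : 'I_k -> operation),
    forall o, OO o <-> exists i, f i = o.

Inductive term (OO : operation -> Prop) (n : nat) :=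
| Var of 'I_n
| App (o : operation) of OO o & ('I_(arity o) -> term OO n).

Fixpoint eval (OO : operation -> Prop) (n : nat) (A : structure n)
    (t : term OO n) : set (dom A * dom A) :=
  match t with
  | Var i => rel_of A i
  | App o _ ts =>
      apply_op o (@Structure (arity o) (dom A) (fun j => @eval OO n A (ts j)))
  end.
Arguments eval {OO n} A t.

Definition term_definable (OO : operation -> Prop) (o : operation)
    (K : structure (arity o) -> Prop) :=
  exists t : term OO (arity o), forall A, K A -> eval A t = apply_op o A.
Arguments term_definable : clear implicits.

Fact op_id_invariant (A B : structure 0) (f : dom A -> dom B) :
  isomorphism f -> forall x y,
  diagonal (x, y) <-> diagonal (f x, f y).
Proof.
move=> [/bij_inj fI _] x y.
by split=> /diagonalP xy; apply/diagonalP; [rewrite xy | exact: fI].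
Qed.

Definition op_id : operation :=
  @Operation 0 (fun _ => diagonal) op_id_invariant.

Fact op_empty_invariant (A B : structure 0) (f : dom A -> dom B) :
  isomorphism f -> forall x y,
  @set0 (dom A * dom A) (x, y) <-> @set0 (dom B * dom B) (f x, f y).
Proof. by []. Qed.

Definition op_empty : operation :=
  @Operation 0 (fun _ => set0) op_empty_invariant.

Fact op_compl_invariant (A B : structure 1) (f : dom A -> dom B) :
  isomorphism f -> forall x y,
  (~` rel_of A ord0) (x, y) <-> (~` rel_of B ord0) (f x, f y).
Proof. by move=> [_ fR] x y; split=> nR /fR. Qed.

Definition op_compl : operation :=
  @Operation 1 (fun A => ~` rel_of A ord0) op_compl_invariant.

Fact op_inter_invariant (A B : structure 2) (f : dom A -> dom B) :
  isomorphism f -> forall x y,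
  (rel_of A ord0 `&` rel_of A ord_max) (x, y) <->
  (rel_of B ord0 `&` rel_of B ord_max) (f x, f y).
Proof. by move=> [_ fR] x y; split=> -[/fR ? /fR ?]. Qed.

Definition op_inter : operation :=
  @Operation 2 (fun A => rel_of A ord0 `&` rel_of A ord_max) op_inter_invariant.

(* The library's [S \; R] relates x to z when R x y and S y z for some y, so
   [op_comp] is left-to-right composition of its two arguments. *)
Fact op_comp_invariant (A B : structure 2) (f : dom A -> dom B) :
  isomorphism f -> forall x y,
  (rel_of A ord_max \; rel_of A ord0) (x, y) <->
  (rel_of B ord_max \; rel_of B ord0) (f x, f y).
Proof.
move=> [[g fK gK] fR] x y; split=> -[z /= R0 R1].
  by exists (f z); apply/fR.
by exists (g z); apply/fR; rewrite gK.
Qed.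

Definition op_comp : operation :=
  @Operation 2 (fun A => rel_of A ord_max \; rel_of A ord0) op_comp_invariant.

Fact op_conv_invariant (A B : structure 1) (f : dom A -> dom B) :
  isomorphism f -> forall x y,
  ((rel_of A ord0)^-1) (x, y) <-> ((rel_of B ord0)^-1) (f x, f y).
Proof. by move=> [_ fR] x y; split=> /fR. Qed.

Definition op_conv : operation :=
  @Operation 1 (fun A => (rel_of A ord0)^-1) op_conv_invariant.

Definition TRA (o : operation) : Prop :=
  o = op_id \/ o = op_empty \/ o = op_compl \/
  o = op_inter \/ o = op_comp \/ o = op_conv.

(* [gso n v s r] is the type of formulas over n relation symbols whose free
   variables are v element variables, s set variables and r binary relation
   variables, all in de Bruijn style: a quantifier binds variable 0 and shifts
   the others by one.  [GExRel i phi] quantifies over the subsets of the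
   interpretation of the i-th relation symbol.  The remaining connectives and
   the universal quantifiers are definable, the semantics being classical. *)
Inductive gso (n : nat) : nat -> nat -> nat -> Type :=
| GEq v s r of 'I_v & 'I_v : gso n v s r
| GRel v s r of 'I_n & 'I_v & 'I_v : gso n v s r
| GSetVar v s r of 'I_s & 'I_v : gso n v s r
| GRelVar v s r of 'I_r & 'I_v & 'I_v : gso n v s r
| GNot v s r of gso n v s r : gso n v s r
| GAnd v s r of gso n v s r & gso n v s r : gso n v s r
| GEx v s r of gso n v.+1 s r : gso n v s r
| GExSet v s r of gso n v s.+1 r : gso n v s r
| GExRel v s r of 'I_n & gso n v s r.+1 : gso n v s r.

Definition env_nil (T : Type) : 'I_0 -> T :=
  fun i => False_rect T (notF (ltn_ord i)).

Definition env_cons (T : Type) (m : nat) (a : T) (e : 'I_m -> T) :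
    'I_m.+1 -> T :=
  fun i => if unlift ord0 i is Some j then e j else a.

Fixpoint sat (n : nat) (A : structure n) (v s r : nat) (phi : gso n v s r) :
    ('I_v -> dom A) -> ('I_s -> set (dom A)) ->
    ('I_r -> set (dom A * dom A)) -> Prop :=
  match phi with
  | GEq _ _ _ x y => fun e _ _ => e x = e y
  | GRel _ _ _ i x y => fun e _ _ => rel_of A i (e x, e y)
  | GSetVar _ _ _ X x => fun e E _ => E X (e x)
  | GRelVar _ _ _ Z x y => fun e _ F => F Z (e x, e y)
  | GNot _ _ _ p => fun e E F => ~ sat p e E F
  | GAnd _ _ _ p q => fun e E F => sat p e E F /\ sat q e E F
  | GEx _ _ _ p => fun e E F => exists a, sat p (env_cons a e) E F
  | GExSet _ _ _ p => fun e E F => exists S, sat p e (env_cons S E) F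
  | GExRel _ _ _ i p => fun e E F =>
      exists2 S, S `<=` rel_of A i & sat p e E (env_cons S F)
  end.

Definition gso_definable (o : operation) :=
  exists phi : gso (arity o) 2 0 0, forall A : structure (arity o),
    apply_op o A =
    [set ab | sat phi (env_cons ab.1 (env_cons ab.2 (@env_nil (dom A))))
                (@env_nil (set (dom A))) (@env_nil (set (dom A * dom A)))].

(* Main.v *)
(** On the blown-up directed cycle C_m (vertices Z_m x bool, one edge for every
    pair of vertices on consecutive levels, the two relations being the
    functions edge -> source and edge -> target), rotations and the exchanges
    of the two vertices of a level are automorphisms.  Hence an invariant
    partial function maps level i into levels i and i + 1 in the same way for
    all i, so it is described by a code in a finite set independent of m.  Thus
    finitely many function-preserving operations act on the codes by one of
    finitely many tables: two cycles C_m and C_n with m < n have the same table,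
    and on them every term has the same code.  However, the intersection of the
    identity with the m-th power of the adjacency relation is nonempty on C_m
    and empty on C_n. *)
Require Import Defs.
From mathcomp Require Import all_boot ssralg zmodp.
From mathcomp Require Import boolp classical_sets functions cardinality.
Import GRing.Theory.

Set Implicit Arguments.
Unset Strict Implicit.
Unset Printing Implicit Defensive.

Lemma eval_isomorphism (OO : operation -> Prop) (n : nat) (t : term OO n)
    (A B : structure n) (f : dom A -> dom B) :
  isomorphism f -> forall x y, eval A t (x, y) <-> eval B t (f x, f y).
Proof.
move=> fI; have [fbij fR] := fI; elim: t => [i|o oO ts IH] x y /=.
  exact: fR.
exact: (@op_invariant o (Structure (fun j => eval A (ts j)))
                        (Structure (fun j => eval B (ts j))) f).
Qed.

Lemma eval_partial_function (OO : operation -> Prop) (n : nat) (t : term OO n)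
    (A : structure n) :
  (forall o, OO o -> function_preserving o) -> all_partial_functions A ->
  partial_function (eval A t).
Proof.
move=> OOf Af; elim: t => [i|o oO ts IH] /=; first exact: Af.
exact: (OOf _ oO (Structure (fun j => eval A (ts j)))).
Qed.

Definition term_operation (OO : operation -> Prop) (n : nat) (t : term OO n) :=
  @Operation n (fun A => eval A t) (eval_isomorphism t).

Section TarskiTerms.
Variable n : nat.
Implicit Types s t : term TRA n.

Definition id_term : term TRA n :=
  App (o := op_id) (or_introl erefl) (@env_nil _).

Definition conv_term t : term TRA n :=
  App (o := op_conv)
    (or_intror (or_intror (or_intror (or_intror (or_intror erefl)))))
    (fun=> t).

Definition inter_term s t : term TRA n :=
  App (o := op_inter) (or_intror (or_intror (or_intror (or_introl erefl))))
    (fun j => if j == ord0 then s else t).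

Definition comp_term s t : term TRA n :=
  App (o := op_comp)
    (or_intror (or_intror (or_intror (or_intror (or_introl erefl)))))
    (fun j => if j == ord0 then s else t).

End TarskiTerms.

Definition adjacency_term : term TRA 2 :=
  comp_term (conv_term (Var TRA ord0)) (Var TRA ord_max).

(* Off by one: this is the [k + 1]-st power of the adjacency relation. *)
Definition walk_term (k : nat) : term TRA 2 :=
  iter k (comp_term adjacency_term) adjacency_term.

(** Intersecting with the identity forces function preservation; walks alone lack it, as each vertex
    of a blown-up cycle has two successors. *)
Definition closed_walk_operation (k : nat) : operation :=
  term_operation (inter_term (id_term 2) (walk_term k)).

Lemma closed_walk_function_preserving (k : nat) :
  function_preserving (closed_walk_operation k).
Proof. by move=> A _ x y z /= [/diagonalP <- _] [/diagonalP <- _]. Qed.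

(* [inl a] is the vertex [a] of a level; [inr (a, b)] is the edge from the
   vertex [a] of that level to the vertex [b] of the next one. *)
Local Notation kind := (bool + bool * bool)%type.

Section BlownUpCycle.
Local Open Scope ring_scope.

Section Cycle.
Variable n : nat.
Local Notation point := ('Z_n.+2 * kind)%type.

Definition source (xy : point * point) : Prop :=
  if xy.1 is (i, inr (a, _)) then xy.2 = (i, inl a) else False.

Definition target (xy : point * point) : Prop :=
  if xy.1 is (i, inr (_, b)) then xy.2 = (i + 1, inl b) else False.

(** There are [n.+2] levels, so that [0] and [1] are always distinct levels. *)
Definition cycle_structure : structure 2 :=
  @Structure 2 point (fun j => if j == ord0 then source else target).

Lemma cycle_partial_functions : all_partial_functions cycle_structure.
Proof.
move=> j [i [a|[a b]]] y z; rewrite /= /rel_of /=.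
all: by case: (j == ord0); rewrite /source /target //= => -> ->.
Qed.

Definition rotate (k : 'Z_n.+2) (x : point) : point := (x.1 + k, x.2).

(** An edge follows its endpoints, the second of which lies one level further; hence the test on
    [x.1 + 1]. *)
Definition flip (j : 'Z_n.+2) (x : point) : point :=
  (x.1, match x.2 with
        | inl a => inl (a (+) (x.1 == j))
        | inr (a, b) => inr (a (+) (x.1 == j), b (+) (x.1 + 1 == j))
        end).

Lemma rotate_isomorphism (k : 'Z_n.+2) :
  isomorphism (A := cycle_structure) (B := cycle_structure) (rotate k).
Proof.
split.
  by exists (rotate (- k)) => -[i u]; rewrite /rotate /= ?addrK ?addrNK.
rewrite /rotate => j [i [a|[a b]]] [i' u'];
  rewrite /= /rel_of /=; case: (j == ord0); rewrite /source /target //=.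
  by split=> [[-> ->] //|E];
    have [/= /addIr -> ->] := (congr1 fst E, congr1 snd E).
rewrite -addrA (addrC k) addrA.
by split=> [[-> ->] //|E];
  have [/= /addIr -> ->] := (congr1 fst E, congr1 snd E).
Qed.

Lemma flip_isomorphism (j : 'Z_n.+2) :
  isomorphism (A := cycle_structure) (B := cycle_structure) (flip j).
Proof.
have flipK : involutive (flip j).
  by move=> [i [a|[a b]]]; rewrite /flip /= ?addbK.
split; first exact: inv_bij.
have flip_vertex a i y :
    y = (i, inl a) <-> flip j y = (i, inl (a (+) (i == j))).
  by split=> [->|Ey]; [|rewrite -[y]flipK Ey /flip /= addbK].
move=> l [i [a|[a b]]] y; rewrite /= /rel_of /=; case: (l == ord0) => //.
  exact: flip_vertex.
exact: flip_vertex.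
Qed.

(* The third component of an element of the code is the level of the value,
   relative to the level of the argument. *)
Definition code (h : set (point * point)) : {set kind * kind * bool} :=
  [set u : kind * kind * bool | `[< h ((0, u.1.1), (u.2%:R, u.1.2)) >]]%SET.

Definition decode (c : {set kind * kind * bool}) : set (point * point) :=
  fun xy => exists2 d : bool,
    (xy.1.2, xy.2.2, d) \in c & xy.2.1 = xy.1.1 + d%:R.

Lemma codeK (h : set (point * point)) :
  partial_function h ->
  (forall f : point -> point,
    isomorphism (A := cycle_structure) (B := cycle_structure) f ->
    forall x y, h (x, y) <-> h (f x, f y)) ->
  decode (code h) = h.
Proof.
move=> hfun hinv; apply/predeqP => -[[i u] [j v]]; rewrite /decode /=.
split=> [[d]|hij].
  rewrite inE => /asboolP /= /(hinv _ (rotate_isomorphism i)).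
  by rewrite /rotate /= add0r addrC => + ->.
have [d jE] : exists d : bool, j = i + d%:R.
  have [->|ji] := eqVneq j i; first by exists false; rewrite addr0.
  have [->|ji1] := eqVneq j (i + 1); first by exists true.
  (* otherwise [flip j] fixes the argument but moves the value *)
  have /(hinv _ (flip_isomorphism j)) := hij.
  have -> : flip j (i, u) = (i, u).
    rewrite /flip /= [i == j]eq_sym (negbTE ji) [i + 1 == j]eq_sym (negbTE ji1).
    by case: u {hij} => [a|[a b]]; rewrite !addbF.
  (* At level [j] the first bit of a vertex or edge is negated, so no point there is fixed. *)
  move=> /(hfun _ _ _ hij); rewrite /flip /= eqxx.
  by case: v {hij} => [[]|[[] b]].
exists d => //; rewrite inE; apply/asboolP => /=.
apply/(hinv _ (rotate_isomorphism i)).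
by rewrite /rotate /= add0r addrC -jE.
Qed.

Lemma eval_adjacency (x y : point) :
  eval cycle_structure adjacency_term (x, y) <->
  exists i a b, x = (i, inl a) /\ y = (i + 1, inl b).
Proof.
split=> [[[i [c|[a b]]] //= sx ty]|[i [a [b [-> ->]]]]].
  by exists i, a, b.
by exists (i, inr (a, b)).
Qed.

Lemma eval_walk (k : nat) (x y : point) :
  eval cycle_structure (walk_term k) (x, y) <->
  exists i a b, x = (i, inl a) /\ y = (i + k.+1%:R, inl b).
Proof.
elim: k x y => [|k IH] x y; first exact: eval_adjacency.
split=> [[z]|[i [a [b [-> ->]]]]].
  move=> /eval_adjacency[i [a [b [/= -> ->]]]] /IH[j [d [c [E /= ->]]]].
  have /= <- := congr1 fst E.
  by exists i, a, c; rewrite -addrA -mulrS.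
exists (i + 1, inl b); first by apply/eval_adjacency; exists i, a, b.
by apply/IH; exists (i + 1), b, b; rewrite -addrA -mulrS.
Qed.

(** A walk of [k.+1] steps climbs exactly [k.+1] levels and may end at either vertex of the level
    reached, so only the level decides whether it can close. *)
Lemma closed_walkP (k : nat) :
  apply_op (closed_walk_operation k) cycle_structure
    ((0, inl false), (0, inl false)) <-> n.+2 %| k.+1.
Proof.
have -> : (n.+2 %| k.+1)%N = (k.+1%:R == 0 :> 'Z_n.+2).
  by rewrite Zp_nat -val_eqE.
split=> [[_ /eval_walk[i [a [b [E]]]]]|/eqP k0].
  by have /= <- := congr1 fst E; rewrite add0r => /(congr1 fst) /= <-.
split; first by apply/diagonalP.
by apply/eval_walk; exists 0, false, false; rewrite k0 addr0.
Qed.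

End Cycle.
End BlownUpCycle.

Section Tables.
Variables (k : nat) (F : 'I_k -> operation).
Hypothesis Ffun : forall i, function_preserving (F i).

Local Notation codes := {set kind * kind * bool}.
Local Notation tables :=
  {dffun forall i : 'I_k, {ffun {ffun 'I_(arity (F i)) -> codes} -> codes}}.

(** The type [tables] is finite and independent of [n], as the pigeonhole argument requires. *)
Definition table (n : nat) : tables :=
  [ffun i => [ffun s : {ffun 'I_(arity (F i)) -> codes} =>
    code (apply_op (F i) (Structure (fun j => @decode n (s j))))]].

(** By induction on the term: source and target have the same codes in all cycles, and each
    operation acts on codes through its table. *)
Lemma eval_code_table (OO : operation -> Prop)
    (OOF : forall o, OO o -> exists i, F i = o) (m n : nat) (t : term OO 2) :
  table m = table n ->
  code (eval (cycle_structure m) t) = code (eval (cycle_structure n) t).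
Proof.
move=> mn; have OOf o : OO o -> function_preserving o by move=> /OOF[i <-].
have decodeK l (s : term OO 2) :
    decode (code (eval (cycle_structure l) s)) = eval (cycle_structure l) s.
  apply: codeK => [|f].
    exact: (eval_partial_function OOf (@cycle_partial_functions l)).
  exact: (@eval_isomorphism _ _ s).
have levelE l (d e : bool) (v w : kind) :
    (d%:R%R : 'Z_l.+2, v) = (e%:R%R, w) <-> d = e /\ v = w.
  split=> [E|[-> ->] //]; have [/= /eqP Ede ->] := (congr1 fst E, congr1 snd E).
  split=> //; case: d e Ede {E} => -[] //;
    by rewrite // ?oner_eq0 // eq_sym oner_eq0.
elim: t => [i|o oO ts IH] /=.
  apply/setP => -[[u v] d]; rewrite !inE; apply: asbool_equiv_eq => /=.
  rewrite /rel_of /=; case: (i == ord0); case: u => [c|[a b]] //=.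
    exact: iff_trans (levelE m d false v _) (iff_sym (levelE n d false v _)).
  rewrite /target /= !add0r.
  exact: iff_trans (levelE m d true v _) (iff_sym (levelE n d true v _)).
have [i Fi] := OOF _ oO; case: o / Fi oO ts IH => oO ts IH.
pose s := [ffun j => code (eval (cycle_structure m) (ts j))].
(* This serves for both cycles: by induction, the argument codes [s] read in the first are also
   those of the second. *)
have tableE l : (forall j, s j = code (eval (cycle_structure l) (ts j))) ->
    code (apply_op (F i)
      (Structure (fun j => eval (cycle_structure l) (ts j)))) = table l i s.
  move=> sE; rewrite !ffunE; congr (code (apply_op _ (Structure _))).
  by apply/funext => j; rewrite sE decodeK.
by rewrite !tableE ?mn // => j; rewrite ffunE ?IH.
Qed.

Lemma table_collision : exists m n : nat, m < n /\ table m = table n.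
Proof.
pose T := fun i : 'I_#|{: tables}|.+1 => table i.
have /injectiveP/injectivePn[i [j ij Tij]] : ~ injective T.
  by move=> /leq_card; rewrite card_ord ltnn.
by move: ij; rewrite -val_eqE neq_ltn => /orP[ij|ji]; [exists i, j|exists j, i].
Qed.

End Tables.

Theorem theorem6 (OO : operation -> Prop)
  (finOO : finite_operations OO)
  (fpOO : forall o : operation, OO o -> function_preserving o)
  (gsoOO : forall o : operation, OO o -> gso_definable o) :
  exists o : operation,
    [/\ function_preserving o,
        term_definable TRA o (fun=> True) &
        ~ term_definable OO o
            (fun A => finite_structure A /\ all_partial_functions A)].
Proof.
have [k [F OOF]] := finOO.
have Ffun i : function_preserving (F i) by apply/fpOO/OOF; exists i.
have [m [n [mn mnT]]] := table_collision F.
(* Index [m.+1] means walks of [m.+2] steps, once around the shorter cycle. *)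
exists (closed_walk_operation m.+1); split.
- exact: closed_walk_function_preserving.
- by eexists=> A _; reflexivity.
move=> [t tE].
have cycleE l : eval (cycle_structure l) t =
    apply_op (closed_walk_operation m.+1) (cycle_structure l).
  by apply: tE; split; [exact: finite_finset | exact: cycle_partial_functions].
have := eval_code_table Ffun (fun o => (OOF o).1) t mnT.
(* This triple records whether the vertex [(0, inl false)] is related to itself. *)
move=> /setP/(_ (inl false, inl false, false)).
rewrite !inE !cycleE => mnE.
have : n.+2 %| m.+2.
  apply/closed_walkP/asboolP; rewrite -mnE; apply/asboolP.
  exact: (closed_walkP m m.+1).2 (dvdnn _).
by move=> /(dvdn_leq (ltn0Sn _)); rewrite leqNgt !ltnS mn.
Qed.
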